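(* Let $A\in\mathbb{C}^{p\times p}$ be a singular matrix, let $k$ be a positive integer, and let $\bar{A}$ be a $k$-commutative $\{1\}$-inverse of $A$. If $X_0\in\mathbb{C}^{p\times p}$ is a particular solution of the matrix system $$AXA=A\quad\wedge\quad A^{k}X=XA^{k}$$ (in the unknown $X\in\mathbb{C}^{p\times p}$), then the general solution of the system is given by the formula $$X=g(Y)=X_{0}+Y-(I-\bar{A}A)YA^{k}\bar{A}^{k}-\bar{A}^{k}A^{k}Y(I-A\bar{A})-\bar{A}AYA\bar{A},$$ where $Y\in\mathbb{C}^{p\times p}$ is arbitrary; that is, for every $Y\in\mathbb{C}^{p\times p}$ the matrix $g(Y)$ is a solution of the system, and every solution $X$ is of the form $X=g(Y)$ for some $Y\in\mathbb{C}^{p\times p}$.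
   Context: A $k$-commutative $\{1\}$-inverse of $A$ is a matrix $\bar{A}\in\mathbb{C}^{p\times p}$ satisfying $A\bar{A}A=A$ and $A^{k}\bar{A}=\bar{A}A^{k}$, i.e. a solution of the system in the statement; $\bar{A}^{k}$ denotes its $k$-th power. $I$ denotes the identity matrix of order $p$. A formula $X=\phi(Y)$ represents the general solution of a system if $\phi(Y)$ is a solution for every $Y$, and every solution $X$ equals $\phi(Y)$ for some $Y$. *)

(* Defs.v *)
From mathcomp Require Import all_boot all_order all_algebra.
From mathcomp Require Import complex.
From mathcomp Require Import reals.

Set Implicit Arguments.
Unset Strict Implicit.
Unset Printing Implicit Defensive.

Import GRing.Theory.
Local Open Scope ring_scope.

Definition k_commutative_1inverse (K : fieldType) (p k : nat)
    (A X : 'M[K]_p) : Prop :=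
  A *m X *m A = A /\ A ^+ k *m X = X *m A ^+ k.

Definition is_general_solution (T U : Type) (sol : T -> Prop)
    (phi : U -> T) : Prop :=
  (forall Y, sol (phi Y)) /\ (forall X, sol X -> exists Y, X = phi Y).

(* Main.v *)
(* The power [A ^+ k] is fixed on either side by each of the idempotents
   [A * Abar] and [Abar * A], and by [A ^+ k * Abar ^+ k]: so every correction
   term of [g] vanishes or telescopes when multiplied by [A] on both sides or by
   [A ^+ k] on one side.  Conversely a solution [X] is [g (X - X0)], because
   [X - X0] solves the homogeneous system [A Y A = 0], [A ^+ k Y = Y A ^+ k], on
   which the three correction terms vanish. *)
Require Import Defs.
From mathcomp Require Import all_boot all_order all_algebra.
From mathcomp Require Import complex.
From mathcomp Require Import reals.

Set Implicit Arguments.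
Unset Strict Implicit.
Unset Printing Implicit Defensive.

Import GRing.Theory.
Local Open Scope ring_scope.

Section CommutativeInnerInverse.
Variables (R : pzRingType) (k : nat) (a b : R).
Hypotheses (k_gt0 : (0 < k)%N) (abaE : a * b * a = a)
  (comm_akb : GRing.comm (a ^+ k) b).

Lemma inner_inv_mul_exp : a * b * a ^+ k = a ^+ k.
Proof. by rewrite -(prednK k_gt0) exprS mulrA abaE. Qed.

Lemma exp_mul_inner_inv : a ^+ k * b * a = a ^+ k.
Proof. by rewrite -(prednK k_gt0) exprSr -!mulrA (mulrA a) abaE. Qed.

(** Here [b] faces a power rather than a single [a]: commuting [a ^+ k] past [b] turns
    [b * a ^+ k.+1] into [a ^+ k * b * a]. *)
Lemma inner_inv_mul_expC : b * a * a ^+ k = a ^+ k.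
Proof.
by rewrite -mulrA -exprS exprSr mulrA -comm_akb exp_mul_inner_inv.
Qed.

Lemma exp_mul_inner_invC : a ^+ k * a * b = a ^+ k.
Proof.
by rewrite -exprSr exprS -mulrA comm_akb mulrA inner_inv_mul_exp.
Qed.

(** Keeping [j] separate from [k] allows induction with [a ^+ k] fixed: moved next to the innermost
    [b * a], it absorbs that pair. *)
Lemma exp_inner_inv_mul_exp j : b ^+ j * a ^+ j * a ^+ k = a ^+ k.
Proof.
elim: j => [|j IHj]; first by rewrite !mul1r.
have comm_aj : a ^+ j * a ^+ k = a ^+ k * a ^+ j by rewrite -!exprD addnC.
rewrite exprSr exprS -!mulrA comm_aj (mulrA a) !(mulrA b) inner_inv_mul_expC.
by rewrite -comm_aj mulrA.
Qed.

Lemma exp_mul_exp_inner_inv : a ^+ k * b ^+ k * a ^+ k = a ^+ k.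
Proof. by rewrite (commrX k comm_akb) exp_inner_inv_mul_exp. Qed.

Variable x0 : R.
Let g y := x0 + y - (1 - b * a) * y * a ^+ k * b ^+ k
  - b ^+ k * a ^+ k * y * (1 - a * b) - b * a * y * a * b.

Lemma general_solution_inner y : a * x0 * a = a -> a * g y * a = a.
Proof.
(* [a * (1 - b * a)] and [(1 - a * b) * a] are zero, and the last correction becomes [a * y * a],
   cancelling the term from [y]. *)
move=> ax0a; rewrite /g !(mulrBr, mulrDr, mulrBl, mulrDl) !(mul1r, mulr1).
rewrite !mulrA abaE ax0a.
rewrite -!(mulrA _ a b) -!(mulrA _ (a * b) a) abaE.
by rewrite !subrr !subr0 addrK.
Qed.

Lemma general_solution_comm y : a ^+ k * x0 = x0 * a ^+ k ->
  a ^+ k * g y = g y * a ^+ k.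
Proof.
move=> comm_x0.
(* The first correction dies; the other two become [a ^+ k * y * (1 - a * b)] and
   [a ^+ k * y * a * b], with sum [a ^+ k * y]. *)
have -> : a ^+ k * g y = a ^+ k * x0.
  rewrite /g !(mulrBr, mulrDr, mulrBl, mulrDl) !(mul1r, mulr1) !mulrA.
  rewrite exp_mul_inner_inv exp_mul_exp_inner_inv subrr subr0.
  by rewrite -addrA -opprD subrK addrK.
rewrite comm_x0; apply/esym.
(* Mirror image: now the second correction dies, and the other two add up to [y * a ^+ k]. *)
rewrite /g !(mulrBr, mulrDr, mulrBl, mulrDl) !(mul1r, mulr1).
rewrite -!(mulrA _ a b) -!(mulrA _ (a * b)) inner_inv_mul_exp.
rewrite -!(mulrA _ (a ^+ k) (b ^+ k)) -!(mulrA _ (a ^+ k * b ^+ k)).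
by rewrite exp_mul_exp_inner_inv subrr subr0 -addrA -opprD subrK addrK.
Qed.

Lemma general_solution_homogeneous y : a * y * a = 0 ->
  a ^+ k * y = y * a ^+ k -> g y = x0 + y.
Proof.
move=> aya0 comm_y; rewrite /g.
(* Commuting [y] with [a ^+ k] brings the power next to [1 - b * a], which it annihilates; likewise
   below for [1 - a * b]. *)
rewrite -(mulrA (1 - b * a)) -comm_y (mulrA (1 - b * a)) mulrBl mul1r.
rewrite inner_inv_mul_expC subrr !mul0r subr0.
rewrite -(mulrA (b ^+ k)) comm_y -!mulrA (mulrBr (a ^+ k)) mulr1 !mulrA.
rewrite exp_mul_inner_invC subrr !mulr0 subr0.
by rewrite -2!(mulrA b) aya0 mulr0 mul0r subr0.
Qed.

End CommutativeInnerInverse.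

Theorem theorem2p6 (R : realType) (p k : nat) (A Abar X0 : 'M[R[i]]_p)
    (hA : A \notin unitmx) (hk : (0 < k)%N)
    (hAbar : k_commutative_1inverse k A Abar)
    (hX0 : A *m X0 *m A = A /\ A ^+ k *m X0 = X0 *m A ^+ k) :
  is_general_solution
    (fun X : 'M[R[i]]_p => A *m X *m A = A /\ A ^+ k *m X = X *m A ^+ k)
    (fun Y : 'M[R[i]]_p =>
       X0 + Y
       - (1%:M - Abar *m A) *m Y *m A ^+ k *m Abar ^+ k
       - Abar ^+ k *m A ^+ k *m Y *m (1%:M - A *m Abar)
       - Abar *m A *m Y *m A *m Abar).
Proof.
case: hAbar hX0 => abaE comm_akb [ax0a comm_x0]; split=> [Y|X [axa comm_x]].
  (* On square matrices [*m] is convertible to the ring product, so the ring lemmas apply as they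
     stand. *)
  split; first exact: (general_solution_inner _ abaE).
  exact: (general_solution_comm hk abaE comm_akb).
exists (X - X0); apply/esym.
rewrite [LHS](general_solution_homogeneous hk abaE comm_akb) ?subrKC //.
  by rewrite mulrBr mulrBl [_ * X * _]axa [_ * X0 * _]ax0a subrr.
by rewrite mulrBr mulrBl [_ * X]comm_x [_ * X0]comm_x0.
Qed.
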